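(* Let $p\ge 1$ and $n\ge 0$ be integers, $(R_i)_{1\le i\le p}$ a family of rings, $(M_i)_{1\le i\le p}$ a family where $M_i$ is an $R_i$-module, $\mathscr{X}^i$ a class of submodules of $M_i$ for each $i\in\{1,\dots,p\}$, and $\mathscr{X}=\prod_{i=1}^p\mathscr{X}^i$. Let $R=\prod_{i=1}^p R_i$. Then $M=\prod_{i=1}^p M_i$ is an $n$-$\mathscr{X}$-coherent $R$-module if and only if $M_i$ is an $n$-$\mathscr{X}^i$-coherent $R_i$-module for each $i=1,\dots,p$.
   Context: Rings are associative with identity (not necessarily commutative); modules are unital left modules. For an integer $k\ge 0$, a module $M$ is $k$-presented if there is an exact sequence $F_k\to F_{k-1}\to\cdots\to F_0\to M\to 0$ with each $F_i$ a finitely generated free module (over the ring in question); every module is regarded as $(-1)$-presented. For a class $\mathscr{X}$ of modules, $\mathscr{X}_k$ denotes the class of $k$-presented modules in $\mathscr{X}$. If $\mathscr{X}$ is a class of submodules of a module $M$, then $M$ is $n$-$\mathscr{X}$-coherent if $\mathscr{X}_{n-1}$ is nonempty and every module in $\mathscr{X}_{n-1}$ is in $\mathscr{X}_n$. $\prod_{i=1}^p\mathscr{X}^i$ denotes the class of the submodules $\prod_{i=1}^p N_i$ of $\prod_{i=1}^p M_i$ with each $N_i$ in $\mathscr{X}^i$. *)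

(* Defs.v *)
From HB Require Import structures.
From mathcomp Require Import all_boot all_algebra.
From mathcomp Require Import boolp classical_sets.

Set Implicit Arguments.
Unset Strict Implicit.
Unset Printing Implicit Defensive.

Import GRing.Theory.

Local Open Scope ring_scope.
Local Open Scope classical_set_scope.

(* The type pzRingType is used for rings: they need not be commutative, and
   the zero ring is allowed.  The type lmodType is that of unital left modules.
   Submodules are the inhabitants of submodClosed; membership in them is
   boolean, which is no restriction since boolp makes every proposition
   equivalent to a boolean; by extensionality and proof irrelevance, which boolp
   also provides, submodules with the same elements are equal. *)

Section DffunZmodule.
Variables (I : finType) (V : I -> zmodType).
Local Notation T := {dffun forall i, V i}.
Implicit Types x y z : T.

Definition dffun_zero : T := finfun (fun i => 0 : V i).
Definition dffun_opp x : T := finfun (fun i => - x i).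
Definition dffun_add x y : T := finfun (fun i => x i + y i).

Fact dffun_addA : associative dffun_add.
Proof. by move=> x y z; apply/ffunP=> i; rewrite !ffunE addrA. Qed.

Fact dffun_addC : commutative dffun_add.
Proof. by move=> x y; apply/ffunP=> i; rewrite !ffunE addrC. Qed.

Fact dffun_add0 : left_id dffun_zero dffun_add.
Proof. by move=> x; apply/ffunP=> i; rewrite !ffunE add0r. Qed.

Fact dffun_addN : left_inverse dffun_zero dffun_opp dffun_add.
Proof. by move=> x; apply/ffunP=> i; rewrite !ffunE addNr. Qed.

HB.instance Definition _ := GRing.isZmodule.Build T
  dffun_addA dffun_addC dffun_add0 dffun_addN.

End DffunZmodule.

Section DffunRing.
Variables (I : finType) (R : I -> pzRingType).
Local Notation T := {dffun forall i, R i}.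
Implicit Types a b c : T.

Definition dffun_one : T := finfun (fun i => 1 : R i).
Definition dffun_mul a b : T := finfun (fun i => a i * b i).

Fact dffun_mulA : associative dffun_mul.
Proof. by move=> a b c; apply/ffunP=> i; rewrite !ffunE mulrA. Qed.

Fact dffun_mul1 : left_id dffun_one dffun_mul.
Proof. by move=> a; apply/ffunP=> i; rewrite !ffunE mul1r. Qed.

Fact dffun_mulr1 : right_id dffun_one dffun_mul.
Proof. by move=> a; apply/ffunP=> i; rewrite !ffunE mulr1. Qed.

Fact dffun_mulDl : left_distributive dffun_mul +%R.
Proof. by move=> a b c; apply/ffunP=> i; rewrite !ffunE mulrDl. Qed.

Fact dffun_mulDr : right_distributive dffun_mul +%R.
Proof. by move=> a b c; apply/ffunP=> i; rewrite !ffunE mulrDr. Qed.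

HB.instance Definition _ := GRing.Zmodule_isPzRing.Build T
  dffun_mulA dffun_mul1 dffun_mulr1 dffun_mulDl dffun_mulDr.

End DffunRing.

Section DffunLmodule.
Variables (I : finType) (R : I -> pzRingType) (M : forall i, lmodType (R i)).
Local Notation S := {dffun forall i, R i}.
Local Notation T := {dffun forall i, M i}.
Implicit Types (a b : S) (x y : T).

Definition dffun_scale a x : T := finfun (fun i => a i *: x i).

Fact dffun_scaleA a b x : dffun_scale a (dffun_scale b x) = dffun_scale (a * b) x.
Proof. by apply/ffunP=> i; rewrite !ffunE scalerA. Qed.

Fact dffun_scale1 : left_id 1 dffun_scale.
Proof. by move=> x; apply/ffunP=> i; rewrite !ffunE scale1r. Qed.

Fact dffun_scaleDr : right_distributive dffun_scale +%R.
Proof. by move=> a x y; apply/ffunP=> i; rewrite !ffunE scalerDr. Qed.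

Fact dffun_scaleDl x : {morph dffun_scale^~ x : a b / a + b}.
Proof. by move=> a b; apply/ffunP=> i; rewrite !ffunE scalerDl. Qed.

HB.instance Definition _ := GRing.Zmodule_isLmodule.Build S T
  dffun_scaleA dffun_scale1 dffun_scaleDr dffun_scaleDl.

Definition prod_submod (N : forall i, submodClosed (M i)) : {pred T} :=
  fun x => [forall i, x i \in N i].

Fact prod_submod_closed N : submod_closed (prod_submod N).
Proof.
split=> [|a x y /forallP Nx /forallP Ny]; apply/forallP=> i; rewrite !ffunE.
  exact: rpred0.
by rewrite rpredD ?rpredZ ?Nx ?Ny.
Qed.

HB.instance Definition _ N :=
  GRing.isSubmodClosed.Build S T (prod_submod N) (prod_submod_closed N).

End DffunLmodule.

(* A submodule, viewed as a module in its own right. *)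
Section SubmodType.
Variables (R : pzRingType) (M : lmodType R) (N : submodClosed M).

Definition submod_type : Type := {x : M | x \in N}.

HB.instance Definition _ := SubChoice.on submod_type.
HB.instance Definition _ := [SubChoice_isSubLmodule of submod_type by <:].

End SubmodType.

Section Coherence.
Variable R : pzRingType.

Definition fg_free (F : lmodType R) : Prop :=
  exists (m : nat) (f : {linear 'rV[R]_m -> F}), bijective f.

Definition exact (A B C : lmodType R) (f : {linear A -> B}) (g : {linear B -> C}) :
  Prop := range f = g @^-1` [set 0].

(* In F_k -> ... -> F_0 -> M -> 0 the modules F_i and the maps
   d_i : F_(i+1) -> F_i are indexed by all i : nat, but nothing is required of
   F_i for i > k, nor of d_i for i >= k.  The integer -1 is Negz 0; smaller
   integers never occur. *)
Definition presented (k : int) (M : lmodType R) : Prop :=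
  match k with
  | Posz k =>
      exists (F : nat -> lmodType R) (d : forall i, {linear F i.+1 -> F i})
             (e : {linear F 0%N -> M}),
        [/\ forall i, (i <= k)%N -> fg_free (F i),
            range e = [set: M],
            (0 < k)%N -> exact (d 0%N) e
          & forall i, (i.+1 < k)%N -> exact (d i.+1) (d i)]
  | Negz _ => True
  end.

Variable M : lmodType R.

Definition presented_in (X : set (submodClosed M)) (k : int) :
  set (submodClosed M) := [set N | X N /\ presented k (submod_type N)].

Definition coherent (n : nat) (X : set (submodClosed M)) : Prop :=
  presented_in X (n%:Z - 1) !=set0 /\
  presented_in X (n%:Z - 1) `<=` presented_in X n%:Z.

End Coherence.

Definition prod_class (I : finType) (R : I -> pzRingType)
    (M : forall i, lmodType (R i)) (X : forall i, set (submodClosed (M i))) :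
    set (submodClosed {dffun forall i, M i}) :=
  [set N | exists2 N_ : forall i, submodClosed (M i),
             forall i, X i (N_ i) & N = prod_submod N_].

(* Main.v *)
(* A product of the [N i] is k-presented over the product ring iff each [N i] is
   k-presented; applied to families differing in one member, this gives the
   theorem.  A resolution by finite free modules is a sequence of matrices, and a
   matrix over the product ring is a family of matrices of the same size over
   the factors, with kernels and row spaces computed componentwise.  The
   resolutions of the factors may have different ranks: they are brought to
   a common rank, one degree at a time, by adding zero generators, each of
   which adds a free direct summand to the kernel. *)

Require Import Defs.
From HB Require Import structures.
From mathcomp Require Import all_boot all_algebra.
From mathcomp Require Import boolp classical_sets.

Set Implicit Arguments.
Unset Strict Implicit.
Unset Printing Implicit Defensive.

Import GRing.Theory.

Local Open Scope ring_scope.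
Local Open Scope classical_set_scope.

(** * Linear combinations as maps out of finite free modules *)

Section LinearCombination.
Variables (R : pzRingType) (M : lmodType R).

Definition lincomb m (g : 'I_m -> M) (v : 'rV[R]_m) : M :=
  \sum_j v 0 j *: g j.

Fact lincomb_is_linear m (g : 'I_m -> M) : linear (lincomb g).
Proof.
move=> a u v; rewrite /lincomb scaler_sumr -big_split /=.
by apply: eq_bigr => j _; rewrite !mxE scalerDl scalerA.
Qed.

HB.instance Definition _ m (g : 'I_m -> M) :=
  GRing.isLinear.Build R 'rV[R]_m M *:%R (lincomb g) (lincomb_is_linear g).

Lemma linear_lincomb m (f : {linear 'rV[R]_m -> M}) v :
  f v = lincomb (fun j => f (delta_mx 0 j)) v.
Proof.
by rewrite {1}[v]row_sum_delta linear_sum; apply: eq_bigr => j _; rewrite linearZ.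
Qed.

End LinearCombination.

Lemma linear_of_lincomb (R : pzRingType) (M M' : lmodType R)
    (f : {linear M -> M'}) m (g : 'I_m -> M) v :
  f (lincomb g v) = lincomb (f \o g) v.
Proof. by rewrite linear_sum; apply: eq_bigr => j _; rewrite linearZ. Qed.

(** A free resolution as iterated matrices: generators of [K], then generators of their relations,
    and so on, [k = 0] being finite generation. Relations are sets of row vectors, so the recursion
    forms no kernel module. *)
Fixpoint fin_presented (R : pzRingType) (k : nat) (M : lmodType R) (K : set M) : Prop :=
  exists m (g : 'I_m -> M), K = range (lincomb g) /\
    if k is k'.+1 then fin_presented k' (lincomb g @^-1` [set 0]) else True.

(** Exposes the first generating family, whose length has to be adjusted later. *)
Definition presented_by (R : pzRingType) (k : nat) (M : lmodType R) (K : set M)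
    (m : nat) (g : 'I_m -> M) : Prop :=
  K = range (lincomb g) /\
    if k is k'.+1 then fin_presented k' (lincomb g @^-1` [set 0]) else True.

Lemma fin_presentedE (R : pzRingType) k (M : lmodType R) (K : set M) :
  fin_presented k K = exists m (g : 'I_m -> M), presented_by k K g.
Proof. by case: k. Qed.

(** * Free resolutions rewritten as iterated generators and relations *)

Section Resolution.
Variable R : pzRingType.
Implicit Types M : lmodType R.

(* [presented] relativized to a submodule [K], so that truncating a resolution
   at its first free module can be expressed without forming kernel types. *)
Definition resolved (k : nat) M (K : set M) : Prop :=
  exists (F : nat -> lmodType R) (d : forall i, {linear F i.+1 -> F i})
         (e : {linear F 0%N -> M}),
    [/\ forall i, (i <= k)%N -> fg_free (F i),
        range e = K,
        (0 < k)%N -> exact (d 0%N) e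
      & forall i, (i.+1 < k)%N -> exact (d i.+1) (d i)].

(** Exactness at [F 0] makes [d 0] map onto the kernel of [e], so the later terms resolve that
    kernel; conversely [F] can be prepended to a resolution of the kernel. *)
Lemma resolvedP k M (K : set M) :
  resolved k K <-> exists (F : lmodType R) (e : {linear F -> M}),
    [/\ fg_free F, range e = K &
        if k is k'.+1 then resolved k' (e @^-1` [set 0]) else True].
Proof.
split=> [[F [d [e [Ff eK ex0 ex]]]]|[F [e [Ff eK]]]].
  exists (F 0%N), e; split=> //; first exact: Ff.
  case: k Ff ex0 ex => // k Ff ex0 ex.
  exists (fun i => F i.+1), (fun i => d i.+1), (d 0%N); split=> [i ik|||i ik].
  - exact: Ff.
  - exact: ex0.
  - by move=> k0; apply: ex.
  - exact: ex.
case: k => [_|k [F' [d' [e' [Ff' eK' ex0' ex']]]]].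
  (* For [k = 0] only [F 0] and [e] are constrained; the other entries are fillers. *)
  by exists (fun=> F), (fun=> \0), e.
pose G i : lmodType R := if i is j.+1 then F' j else F.
pose D i : {linear G i.+1 -> G i} := if i is j.+1 then d' j else e'.
exists G, D, e; split=> //.
- by case=> // i ik; apply: Ff'.
- by case=> [|i] ik; [apply: ex0' | apply: ex'].
Qed.

Lemma resolvedE k M (K : set M) : resolved k K <-> fin_presented k K.
Proof.
elim: k M K => [|k IH] M K; rewrite resolvedP.
  split=> [[F [e [[m [f [f' fK f'K]]] eK _]]]|[m [g [-> _]]]].
    pose h : {linear _ -> _} := e \o f.
    exists m, (fun j => h (delta_mx 0 j)); split=> //; rewrite -eK.
    apply/seteqP; split=> x [y _ <-].
      by exists (f' y) => //; rewrite -(linear_lincomb h) /= f'K.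
    by exists (f y) => //; rewrite -(linear_lincomb h).
  exists 'rV[R]_m, (lincomb g); split=> //.
  by exists m, idfun; exists idfun.
split=> [[F [e [[m [f [f' fK f'K]]] eK /IH]]]|[m [g [-> /IH gK]]]]; last first.
  exists 'rV[R]_m, (lincomb g); split=> //.
  by exists m, idfun; exists idfun.
rewrite fin_presentedE => -[r [h [hK hk]]].
pose ef : {linear _ -> _} := e \o f.
exists m, (fun j => ef (delta_mx 0 j)); split.
  rewrite -eK; apply/seteqP; split=> x [y _ <-].
    by exists (f' y) => //; rewrite -(linear_lincomb ef) /= f'K.
  by exists (f y) => //; rewrite -(linear_lincomb ef).
(* [f'] carries no linear structure, so combinations of the pulled-back generators are compared
   through [f]. *)
have fh v : f (lincomb (f' \o h) v) = lincomb h v.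
  by rewrite linear_of_lincomb; apply: eq_bigr => j _ /=; rewrite f'K.
have kerE : lincomb (f' \o h) @^-1` [set 0] = lincomb h @^-1` [set 0].
  apply/seteqP; split=> v /= hv; first by rewrite -fh hv linear0.
  by apply: (can_inj fK); rewrite fh hv linear0.
rewrite fin_presentedE; exists r, (f' \o h); split;
  last by case: (k) hk => // k'; rewrite kerE.
apply/seteqP; split=> [v /=|_ [w _ <-]]; rewrite /= -(linear_lincomb ef) /=.
  move=> fv0; have : (e @^-1` [set 0]) (f v) by [].
  rewrite hK => -[w _ hw]; exists w => //.
  by apply: (can_inj fK); rewrite fh.
have : range (lincomb h) (lincomb h w) by exists w.
by rewrite -hK fh.
Qed.

Lemma presentedE (k : nat) M : presented k M <-> fin_presented k [set: M].
Proof. exact: resolvedE. Qed.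

(** [val] is linear and injective, so a family in the submodule has the same relations as its image
    in [M]. *)
Lemma presented_submodE (k : nat) M (N : submodClosed M) :
  presented k (submod_type N) <-> fin_presented k [set x | x \in N].
Proof.
have vcomb m (g : 'I_m -> submod_type N) v : val (lincomb g v) = lincomb (val \o g) v.
  by rewrite linear_of_lincomb.
have kerE m (g : 'I_m -> submod_type N) :
    lincomb g @^-1` [set 0] = lincomb (val \o g) @^-1` [set 0].
  apply/seteqP; split=> v /= gv; first by rewrite -vcomb gv raddf0.
  by apply: val_inj; rewrite vcomb gv raddf0.
rewrite presentedE !fin_presentedE; split=> -[m [g [gK gk]]].
  exists m, (val \o g); split; last by case: (k) gk => // k'; rewrite kerE.
  apply/seteqP; split=> [x /= xN|_ [v _ <-] /=]; last by rewrite -vcomb; apply: valP.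
  have : [set: submod_type N] (Sub x xN) by [].
  by rewrite gK => -[v _ gv]; exists v => //; rewrite -vcomb gv.
(* Each generator is the value at a unit vector, hence lies in [N] and lifts to the submodule. *)
have gN j : g j \in N.
  have : range (lincomb g) (g j).
    exists (delta_mx 0 j) => //; rewrite /lincomb (bigD1 j) //= big1 => [|i ij].
      by rewrite mxE !eqxx scale1r addr0.
    by rewrite mxE (negPf ij) andbF scale0r.
  by rewrite -gK.
pose h j : submod_type N := Sub (g j) (gN j).
have hg : val \o h = g by apply/funext.
exists m, h; split; last by case: (k) gk => // k'; rewrite kerE hg.
apply/seteqP; split=> // x _; have : range (lincomb g) (val x).
  by rewrite -gK; apply: valP.
by case=> v _ gv; exists v => //; apply: val_inj; rewrite vcomb hg gv.
Qed.

(** Injectivity keeps the relations unchanged; only the first generating family is moved. *)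
Lemma fin_presented_image k M M' (f : {linear M -> M'}) (K : set M) :
  injective f -> fin_presented k K -> fin_presented k (f @` K).
Proof.
move=> finj; rewrite !fin_presentedE => -[m [g [-> gk]]].
exists m, (f \o g); split.
  apply/seteqP; split=> [_ [_ [v _ <-] <-]|_ [v _ <-]].
    by exists v => //; rewrite linear_of_lincomb.
  by exists (lincomb g v); [exists v | rewrite linear_of_lincomb].
case: k gk => // k; congr (fin_presented k _); apply/seteqP; split=> v /= gv.
  by rewrite -linear_of_lincomb gv linear0.
by apply: finj; rewrite linear_of_lincomb gv linear0.
Qed.

(** * Enlarging a generating family by zeros *)

Definition fam_cat (T : Type) m a (g : 'I_m -> T) (h : 'I_a -> T) (j : 'I_(m + a)) :=
  match split j with inl i => g i | inr i => h i end.

Lemma lincomb_cat M m a (g : 'I_m -> M) (h : 'I_a -> M) v :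
  lincomb (fam_cat g h) v = lincomb g (lsubmx v) + lincomb h (rsubmx v).
Proof.
rewrite /lincomb big_split_ord /=; congr (_ + _); apply: eq_bigr => j _;
  rewrite mxE /fam_cat.
  by rewrite (unsplitK (inl j)).
by rewrite (unsplitK (inr j)).
Qed.

Lemma lincomb_delta m (v : 'rV[R]_m) : lincomb (delta_mx 0) v = v.
Proof. by rewrite [RHS]row_sum_delta. Qed.

Lemma lincomb0 M m v : lincomb (fun _ : 'I_m => 0 : M) v = 0.
Proof. by rewrite /lincomb big1 // => j _; rewrite scaler0. Qed.

(** Named so that both inclusions carry the linear structure that [linear_of_lincomb] requires. *)
Definition row0_mx m a (v : 'rV[R]_m) : 'rV[R]_(m + a) := row_mx v 0.
Definition row_0mx m a (v : 'rV[R]_a) : 'rV[R]_(m + a) := row_mx 0 v.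

Fact row0_mx_is_linear m a : linear (@row0_mx m a).
Proof. by move=> c u v; rewrite /row0_mx scale_row_mx add_row_mx scaler0 addr0. Qed.

Fact row_0mx_is_linear m a : linear (@row_0mx m a).
Proof. by move=> c u v; rewrite /row_0mx scale_row_mx add_row_mx scaler0 addr0. Qed.

HB.instance Definition _ m a := GRing.isLinear.Build R 'rV[R]_m 'rV[R]_(m + a) *:%R
  (@row0_mx m a) (@row0_mx_is_linear m a).
HB.instance Definition _ m a := GRing.isLinear.Build R 'rV[R]_a 'rV[R]_(m + a) *:%R
  (@row_0mx m a) (@row_0mx_is_linear m a).

(** The set is [K] plus a free summand: the last [a] unit vectors join the generators. They enter no
    relation, so the relations are the old ones extended by zeros. *)
Lemma fin_presented_lsubmx k m a (K : set 'rV[R]_m) :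
  fin_presented k K -> fin_presented k [set v : 'rV[R]_(m + a) | K (lsubmx v)].
Proof.
rewrite !fin_presentedE => -[r [g [-> gk]]].
pose h := fam_cat (@row0_mx m a \o g) (@row_0mx m a \o delta_mx 0).
have hE v : lincomb h v = row_mx (lincomb g (lsubmx v)) (rsubmx v).
  rewrite lincomb_cat -!linear_of_lincomb lincomb_delta.
  by rewrite add_row_mx addr0 add0r.
exists (r + a)%N, h; split.
  apply/seteqP; split=> [v [w _ wv]|_ [v _ <-]] /=.
    by exists (row_mx w (rsubmx v)) => //; rewrite hE row_mxKl row_mxKr wv hsubmxK.
  by exists (lsubmx v) => //; rewrite hE row_mxKl.
case: k gk => // k /(@fin_presented_image _ _ _ (@row0_mx r a)) gk.
have {}gk := gk (fun u v uv => (eq_row_mx uv).1).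
congr (fin_presented k _): gk; apply/seteqP; split=> [_ [v /= gv <-]|v] /=.
  by rewrite hE /row0_mx row_mxKl row_mxKr gv row_mx0.
rewrite hE -row_mx0 => /eq_row_mx [gv rv].
by exists (lsubmx v) => //; rewrite /row0_mx -rv hsubmxK.
Qed.

(** Zero generators keep the range and add to the relations the free summand of
    [fin_presented_lsubmx]. *)
Lemma presented_by_pad k M (K : set M) m (g : 'I_m -> M) m' :
  presented_by k K g -> (m <= m')%N -> exists g' : 'I_m' -> M, presented_by k K g'.
Proof.
move=> [-> gk] /subnKC <-; set a := (m' - m)%N.
exists (fam_cat g (fun=> 0)).
have gE v : lincomb (fam_cat g (fun _ : 'I_a => 0)) v = lincomb g (lsubmx v).
  by rewrite lincomb_cat lincomb0 addr0.
split.
  apply/seteqP; split=> _ [v _ <-].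
    by exists (row0_mx a v) => //; rewrite gE row_mxKl.
  by exists (lsubmx v) => //; rewrite gE.
case: k gk => // k /(@fin_presented_lsubmx _ _ a).
by congr (fin_presented k _); apply/seteqP; split=> v /=; rewrite gE.
Qed.

End Resolution.

(** * Presentations over the product ring *)

Section Product.
Variables (I : finType) (R : I -> pzRingType).
Local Notation S := {dffun forall i, R i}.

(* Abstracts over the two modules to which the induction applies: the product
   of the [M i], and then, for the relations, the row vectors over [S], which
   are not literally a product of the row vectors over the [R i]. *)
Definition is_product (M : lmodType S) (M_ : forall i, lmodType (R i))
    (pr : forall i, M -> M_ i) : Prop :=
  [/\ forall i x y, pr i (x + y) = pr i x + pr i y,
      forall i (a : S) x, pr i (a *: x) = a i *: pr i x,
      forall f : forall i, M_ i, exists x, forall i, pr i x = f i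
    & forall x y, (forall i, pr i x = pr i y) -> x = y].

Definition row_proj m i (v : 'rV[S]_m) : 'rV[R i]_m := \row_j v 0 j i.

Lemma dffun_is_product (M_ : forall i, lmodType (R i)) :
  @is_product {dffun forall i, M_ i} M_ (fun i x => x i).
Proof.
split=> [i x y|i a x|f|x y /ffunP //]; try by rewrite ffunE.
by exists (finfun f : {dffun _}) => i; rewrite ffunE.
Qed.

Lemma row_is_product m :
  @is_product 'rV[S]_m (fun i => 'rV[R i]_m) (@row_proj m).
Proof.
split=> [i x y|i a x|f|x y xy].
- by apply/rowP => j; rewrite !mxE ffunE.
- by apply/rowP => j; rewrite !mxE ffunE.
- exists (\row_j (finfun (fun i => f i 0 j) : S)) => i.
  by apply/rowP => j; rewrite !mxE ffunE.
- apply/rowP => j; apply/ffunP => i.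
  by have /rowP /(_ j) := xy i; rewrite !mxE.
Qed.

Section LincombProj.
Variables (M : lmodType S) (M_ : forall i, lmodType (R i)).
Variables (pr : forall i, M -> M_ i) (prP : is_product pr).

Lemma proj0 i : pr i 0 = 0.
Proof. by have [pD _ _ _] := prP; apply: (addrI (pr i 0)); rewrite -pD !addr0. Qed.

Lemma proj_lincomb m (g : 'I_m -> M) v i :
  pr i (lincomb g v) = lincomb (pr i \o g) (row_proj i v).
Proof.
have [pD pZ _ _] := prP.
rewrite /lincomb (big_morph (pr i) (pD i) (proj0 i)).
by apply: eq_bigr => j _; rewrite pZ mxE.
Qed.

(** Joint injectivity of the projections makes the relations a product set again, the shape to which
    the induction applies. *)
Lemma ker_lincomb_proj m (g : 'I_m -> M) :
  lincomb g @^-1` [set 0] =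
  [set v | forall i, (lincomb (pr i \o g) @^-1` [set 0]) (row_proj i v)].
Proof.
apply/seteqP; split=> v /= gv => [i|]; first by rewrite -proj_lincomb gv proj0.
have [_ _ _ pI] := prP; apply: pI => i.
by rewrite proj_lincomb gv proj0.
Qed.

(** From left to right, elements and coefficients supported on a single component are used; from
    right to left, coefficients chosen in each component are glued into a row over [S]. *)
Lemma range_lincomb_proj m (g : 'I_m -> M) (K : forall i, set (M_ i)) :
  [set x | forall i, K i (pr i x)] = range (lincomb g) <->
  forall i, K i = range (lincomb (pr i \o g)).
Proof.
have [_ _ pS pI] := prP; have [_ _ rS _] := row_is_product m.
split=> [gK i|gK].
  (* Ensures that an element of [K i] extended by zeros lies in the product set. *)
  have K0 j : K j 0.
    have : range (lincomb g) 0 by exists 0 => //; rewrite linear0.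
    by rewrite -gK => /(_ j); rewrite proj0.
  apply/seteqP; split=> [y Ky|_ [v _ <-]].
    have [x px] := pS (@dfwith I M_ (fun=> 0) i y).
    have : range (lincomb g) x.
      rewrite -gK /= => j; rewrite px; have [->|ji] := eqVneq j i.
        by rewrite dfwith_in.
      by rewrite dfwith_out 1?eq_sym.
    case=> v _ vx; exists (row_proj i v) => //.
    by rewrite -proj_lincomb vx px dfwith_in.
  have [w wv] := rS (@dfwith I (fun i => 'rV[R i]_m) (fun=> 0) i v).
  have : range (lincomb g) (lincomb g w) by exists w.
  by rewrite -gK => /(_ i); rewrite proj_lincomb wv dfwith_in.
apply/seteqP; split=> [x /= Kx|_ [v _ <-] i]; last first.
  by rewrite gK proj_lincomb; exists (row_proj i v).
have f i : {v | lincomb (pr i \o g) v = pr i x}.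
  by apply/cid; have := Kx i; rewrite gK => -[v _ vx]; exists v.
have [w wv] := rS (fun i => sval (f i)).
by exists w => //; apply: pI => i; rewrite proj_lincomb wv (svalP (f i)).
Qed.

End LincombProj.

Lemma fin_presented_product k (M : lmodType S) (M_ : forall i, lmodType (R i))
    (pr : forall i, M -> M_ i) (K : forall i, set (M_ i)) : is_product pr ->
  fin_presented k [set x | forall i, K i (pr i x)] <->
  forall i, fin_presented k (K i).
Proof.
elim/ltn_ind: k M M_ pr K => k IH M M_ pr K prP.
(* A family over the product has the same length in every component, so its conditions split
   componentwise. *)
have byP m (g : 'I_m -> M) :
    presented_by k [set x | forall i, K i (pr i x)] g <->
    forall i, presented_by k (K i) (pr i \o g).
  split=> [[/(range_lincomb_proj prP) gK gk] i|gK].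
    split=> //; case: k IH gk => // k IH; rewrite (ker_lincomb_proj prP) => gk.
    by move: i; apply/(IH k (ltnSn k) _ _ _
      (fun i => lincomb (pr i \o g) @^-1` [set 0]) (row_is_product m)).
  split; first by apply/(range_lincomb_proj prP) => i; have [] := gK i.
  case: k IH gK => // k IH gK; rewrite (ker_lincomb_proj prP).
  apply/(IH k (ltnSn k) _ _ _
    (fun i => lincomb (pr i \o g) @^-1` [set 0]) (row_is_product m)) => i.
  by have [] := gK i.
rewrite fin_presentedE; split=> [[m [g /byP gK]] i|Kk].
  by rewrite fin_presentedE; exists m, (pr i \o g).
have gen i : {m & {g : 'I_m -> M_ i | presented_by k (K i) g}}.
  have := Kk i; rewrite fin_presentedE => /cid[m /cid[g gK]].
  by exists m, g.
(* The largest length among the factors; all families are padded to it and then glued. *)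
pose m := \max_i tag (gen i).
have padded i : {g : 'I_m -> M_ i | presented_by k (K i) g}.
  apply/cid; case: (gen i) (@leq_bigmax _ (fun j => tag (gen j)) i) => r [g gK] /=.
  exact: presented_by_pad gK.
have [_ _ pS _] := prP.
have /choice [g gE] : forall j, exists x, forall i, pr i x = sval (padded i) j.
  by move=> j; exact: (pS (fun i => sval (padded i) j)).
exists m, g; apply/byP => i.
have -> : pr i \o g = sval (padded i) by apply/funext => j; rewrite /= gE.
exact: (svalP (padded i)).
Qed.

(** [P] is kept apart from [prod_submod N] because a member of [prod_class] is given only up to an
    equation. *)
Lemma presented_prod_submod (k : int) (M : forall i, lmodType (R i))
    (N : forall i, submodClosed (M i))
    (P : submodClosed {dffun forall i, M i}) : P = prod_submod N :> {pred _} ->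
  presented k (submod_type P) <-> forall i, presented k (submod_type (N i)).
Proof.
(* In degree -1, which occurs for [n = 0], both sides hold trivially. *)
move=> PN; case: k => [k|//]; rewrite presented_submodE PN.
have -> : [set x | x \in prod_submod N] =
    [set x : {dffun forall i, M i} | forall i, [set y | y \in N i] (x i)].
  by apply/seteqP; split=> x /= /forallP.
rewrite (fin_presented_product k (fun i => [set y | y \in N i])
  (dffun_is_product M)).
by split=> Nk i; apply/presented_submodE.
Qed.

End Product.

(** * Transfer of coherence between a product and its factors *)

Theorem theorem2p20 (p n : nat) (hp : (1 <= p)%N)
    (R : 'I_p -> pzRingType) (M : forall i, lmodType (R i))
    (X : forall i, set (submodClosed (M i))) :
  @coherent {dffun forall i, R i} {dffun forall i, M i} n (prod_class X) <->
  forall i, @coherent (R i) (M i) n (X i).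
Proof.
split=> [[[P [[N XN PN] /(presented_prod_submod _ PN) Nn]] coh] i|coh].
  split=> [|N' [XN' N'n]]; first by exists (N i).
  (* [N'] replaces the member [i] of the family [N] given by nonemptiness. All members stay
     [(n-1)]-presented, so coherence of the product applies and yields that [N'] is
     [n]-presented. *)
  pose N1 := @dfwith _ (fun i => submodClosed (M i)) N i N'.
  have N1i : N1 i = N' by apply: dfwith_in.
  have [|_ /(presented_prod_submod _ erefl) /(_ i)] := coh (prod_submod N1);
    last by rewrite N1i.
  split; first by exists N1 => // j; rewrite /N1; case: dfwithP.
  by apply/(presented_prod_submod _ erefl) => j; rewrite /N1; case: dfwithP.
split=> [|P [[N XN PN] /(presented_prod_submod _ PN) Nn]].
  have N i : {N | presented_in (X i) (n%:Z - 1) N} by apply/cid; have [] := coh i.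
  pose P : submodClosed {dffun forall i, M i} := prod_submod (fun i => sval (N i)).
  exists P; split.
    by exists (fun i => sval (N i)) => // i; have [] := svalP (N i).
  by apply/(presented_prod_submod _ erefl) => i; have [] := svalP (N i).
split; first by exists N.
by apply/(presented_prod_submod _ PN) => i; have [_ /(_ (N i)) []] := coh i.
Qed.
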